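(* If $T=[T_1,\ldots,T_n]$, $T_i\in B(\mathcal H)$, is a row contraction such that $$T_1T_1^*+\cdots+T_nT_n^*\ne I$$ and there is a non-zero vector $h\in\mathcal H$ such that $\sum_{|\alpha|=k}\|T_\alpha^*h\|^2=\|h\|^2$ for any $k=1,2,\ldots$, then there is a non-trivial joint invariant subspace (different from $\{0\}$ and $\mathcal H$) under the operators $T_1,\ldots,T_n$.
   Context: $n\in\{1,2,\ldots\}$ or $n=\infty$ (infinite sums converge strongly); $T=[T_1,\ldots,T_n]$ with $T_i$ bounded operators on a complex Hilbert space $\mathcal H$ is a row contraction if $\sum_iT_iT_i^*\le I$. $\mathbb F_n^+$ is the free semigroup with generators $g_1,\ldots,g_n$; for $\alpha=g_{i_1}\cdots g_{i_k}$, $|\alpha|=k$ and $T_\alpha=T_{i_1}\cdots T_{i_k}$. Subspaces are closed. *)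

(* Defs.v *)
From HB Require Import structures.
From mathcomp Require Import all_boot all_order all_algebra.
From mathcomp Require Import sesquilinear.
From mathcomp Require Import complex.
From mathcomp Require Import boolp classical_sets reals ereal topology normedtype.
From mathcomp Require Import sequences esum.

Set Implicit Arguments.
Unset Strict Implicit.
Unset Printing Implicit Defensive.

Import Order.TTheory GRing.Theory Num.Theory.
Import numFieldNormedType.Exports.

Local Open Scope classical_set_scope.
Local Open Scope ring_scope.

(* [Some m] stands for the finite number m of operators, [None] for n = oo. *)
Definition gen (n : option nat) : choiceType :=
  match n with Some m => 'I_m | None => nat end.

(* The free semigroup (with unit the empty word) on n generators; the length
   |alpha| of a word is its [size]. *)
Definition word (n : option nat) := seq (gen n).

(* T_alpha = T_(i_1) ... T_(i_k) for alpha = g_(i_1) ... g_(i_k). *)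
Definition word_op (n : option nat) (V : Type) (T : gen n -> V -> V)
    (alpha : word n) : V -> V :=
  foldr (fun i f => T i \o f) idfun alpha.

Section Operators.
Variables (R : realType) (H : completeNormedModType R[i]).

(* The norm of H takes values in R[i]; its values are nonnegative reals, and
   [rnorm] is the same number seen in R. *)
Definition rnorm (x : H) : R := complex.Re `|x|.

Definition bounded_op (A : H -> H) : Prop :=
  exists M : R, forall x, rnorm (A x) <= M * rnorm x.

(* S = \sum_i A_i; for infinitely many operators the partial sums converge to
   S in the strong operator topology, that is, pointwise in norm. *)
Definition strong_sum (n : option nat) :
    (gen n -> H -> H) -> (H -> H) -> Prop :=
  match n with
  | Some m => fun A S => forall x, \sum_(i < m) A i x = S x
  | None => fun A S =>
      forall x, (fun N : nat => \sum_(i < N) A i x) @ \oo --> S x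
  end.

Definition closed_subspace (M : set H) : Prop :=
  [/\ closed M, M 0 & forall (a : R[i]) x y, M x -> M y -> M (a *: x + y)].

Section InnerProduct.
Variable dot : {dot H for @Num.conj R[i]}.

(* The Hilbert space adjoint: [adjoint A y] is the vector z such that
   <A x, y> = <x, z> for all x, which exists and is unique for a bounded linear
   operator A. The value is 0 when there is no such z. *)
Definition adjoint (A : H -> H) (y : H) : H :=
  xget 0 [set z | forall x, dot (A x) y = dot x z].

(* A <= B for operators: B - A is positive. *)
Definition op_le (A B : H -> H) : Prop :=
  forall x, 0 <= dot (B x - A x) x.

Definition row_contraction (n : option nat) (T : gen n -> H -> H) : Prop :=
  exists2 S : H -> H,
    strong_sum (fun i => T i \o adjoint (T i)) S & op_le S idfun.

End InnerProduct.
End Operators.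

(* Main.v *)
Require Import Defs.
From mathcomp Require Import all_boot all_order all_algebra.
From mathcomp Require Import sesquilinear.
From mathcomp Require Import complex.
From mathcomp Require Import boolp classical_sets reals ereal topology normedtype.
From mathcomp Require Import sequences esum.
From mathcomp Require Import cardinality fsbigop ring.

Set Implicit Arguments.
Unset Strict Implicit.
Unset Printing Implicit Defensive.

Import Order.TTheory GRing.Theory Num.Theory.
Import numFieldNormedType.Exports.

Local Open Scope classical_set_scope.
Local Open Scope ring_scope.

(** Let [S] be the sum of the operators T_i T_i^*, so that I - S is positive, and
    call a vector [x] isometric when the sum of |T_alpha^* x|^2 over the words
    of length k is |x|^2 for every k.  The required subspace consists of the
    vectors orthogonal to all isometric vectors.

    The sum over the words of length k+1 at [x] is the sum over i of the sums
    over the words of length k at T_i^* x, each of which is at most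
    |T_i^* x|^2, and these squares add up to at most |x|^2.  If [x] is
    isometric, all these bounds are equalities.  Hence each T_i^* x is again
    isometric ([isometric_at_adjoint]), which makes the orthogonal complement
    invariant under T_i.  The case k = 0 says that the positive operator I - S
    has a vanishing quadratic form at [x], so that S x = x
    ([isometric_at_fixed]).

    The vector [h] is isometric and nonzero, so the complement is not the whole
    space.  Since I - S is self-adjoint and kills the isometric vectors, its
    range lies in the complement; this range is nonzero because S is not the
    identity.

    Adjoints of bounded operators exist by the Riesz representation theorem
    ([riesz_representation]).  One elementary estimate, [quadratic_bound],
    yields the Cauchy-Schwarz inequality for the inner product, the fact
    S x = x above, and the Riesz theorem, where it turns an approximate
    minimizer of an energy into an approximate representing vector. *)

(** * Estimates and limits of scalars *)

(** Choosing c = - g^* / q minimizes the quadratic form; when q = 0 the form is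
    affine in c along the direction of g^*, and being bounded below it forces
    g = 0. *)
Lemma quadratic_bound (C : numClosedFieldType) (e g q : C) : 0 <= e -> 0 <= q ->
  (forall c, 0 <= e + (c * g + (c * g)^*) + `|c| ^+ 2 * q) ->
  `|g| ^+ 2 <= e * q.
Proof.
move=> e0 q0 P.
have [->|gN0] := eqVneq g 0; first by rewrite normr0 expr0n mulr_ge0.
have [qz|qN0] := eqVneq q 0.
  (* any c with c * g < - e / 2 contradicts the lower bound *)
  have := P (- ((e + 1) / g)).
  rewrite qz mulr0 addr0 mulNr divfK//.
  rewrite (CrealP _); last by rewrite realN ger0_real ?addr_ge0.
  have -> : e + (- (e + 1) - (e + 1)) = - (e + 2) by ring.
  by rewrite oppr_ge0 => /le_gtF; rewrite ltr_wpDl.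
have qp : 0 < q by rewrite lt_def qN0.
have := P (- (g^* / q)).
have -> : - (g^* / q) * g = - (`|g| ^+ 2 / q) by rewrite normCK; ring.
rewrite (CrealP _); last by rewrite realN ger0_real ?divr_ge0 ?exprn_ge0.
rewrite normrN normrM normfV norm_conjC (ger0_norm q0).
have -> : e + (- (`|g| ^+ 2 / q) - (`|g| ^+ 2 / q)) + (`|g| / q) ^+ 2 * q =
          e - `|g| ^+ 2 / q by field.
by rewrite subr_ge0 ler_pdivrMr.
Qed.

Lemma natSinv_lt (R : realType) (e : R[i]) :
  0 < e -> \forall k \near \oo, k.+1%:R^-1 < e.
Proof.
move=> e0; have eE : e = (complex.Re e)%:C%C by rewrite RRe_real// gtr0_real.
have re0 : 0 < complex.Re e by rewrite -ltcR -eE.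
near=> k.
rewrite eE; have -> : k.+1%:R^-1 = (k.+1%:R^-1)%:C%C :> R[i].
  by rewrite fmorphV rmorph_nat.
rewrite ltcR; near: k; exact: near_infty_natSinv_lt (PosNum re0).
Unshelve. all: by end_near. Qed.

Lemma Re_cvg (R : realType) (T : Type) (F : set_system T) {FF : Filter F}
    (u : T -> (R[i] : numFieldType)) (z : (R[i] : numFieldType)) :
  u @ F --> z -> (fun t => complex.Re (u t)) @ F --> complex.Re z.
Proof.
move=> /cvgrPdist_lt uz; apply/cvgrPdist_lt => e e0.
have /uz : (0 : R[i]) < e%:C%C by rewrite ltcR.
apply: filterS => t; rewrite -ltcR; apply: le_lt_trans.
apply: le_trans (normc_ge_Re _); rewrite lecR.
by case: (u t); case: z {uz}.
Qed.

(** A strict inequality at one index would survive in the sum, the rest of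
    which is finite; so comparing the total sums in the reverse direction
    forces equality of the terms. *)
Lemma esum_squeeze_eq (R : realType) (I : choiceType) (f g : I -> \bar R) :
  (forall i, 0 <= f i <= g i)%E ->
  (\esum_(i in [set: I]) g i < +oo)%E ->
  (\esum_(i in [set: I]) g i <= \esum_(i in [set: I]) f i)%E ->
  f = g.
Proof.
move=> fg goo gf; apply/funext => i.
have f0 j : (0 <= f j)%E by case/andP: (fg j).
have g0 j : (0 <= g j)%E by case/andP: (fg j) => /le_trans; apply.
have lefg j : (f j <= g j)%E by case/andP: (fg j).
apply/eqP; rewrite eq_le lefg/=.
have rest : (\esum_(j in [set: I] `&` ~` [set i]) f j <=
             \esum_(j in [set: I] `&` ~` [set i]) g j)%E by exact: le_esum.
have r0 : (0 <= \esum_(j in [set: I] `&` ~` [set i]) f j)%E by exact: esum_ge0.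
move: goo gf; rewrite (esumID [set i] _ g)// (esumID [set i] _ f)//.
rewrite !setTI !esum_set1// => goo gf; rewrite !setTI in rest r0.
have restfin : (\esum_(j in ~` [set i]) f j)%E \is a fin_num.
  rewrite ge0_fin_numE//; apply: le_lt_trans goo; apply: (le_trans rest).
  by rewrite leeDr.
rewrite -(leeD2rE _ _ restfin).
by apply: le_trans gf; rewrite leeD2l.
Qed.

(** For finitely many generators the list is constant in [N]: finite sums and
    strong limits of partial sums are then both limits along [exhaustion]. *)
Definition exhaustion (n : option nat) : nat -> seq (gen n) :=
  match n with Some m => fun _ => enum 'I_m | None => iota 0 end.

Lemma strong_sum_cvg (R : realType) (H : completeNormedModType R[i])
    (n : option nat) (A : gen n -> H -> H) (S : H -> H) : strong_sum A S ->
  forall x, (fun N => \sum_(i <- exhaustion n N) A i x) @ \oo --> S x.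
Proof.
case: n A => [m|] A /= AS x.
  by rewrite big_enum/= AS; exact: cvg_cst.
rewrite (_ : (fun _ => _) = (fun N => \sum_(i < N) A i x))//.
by apply/funext => N; rewrite -[N in iota 0 N]subn0 big_mkord.
Qed.

Lemma esum_cvg (R : realType) (n : option nat) (a : gen n -> R) :
  (forall i, 0 <= a i) ->
  (fun N => (\sum_(i <- exhaustion n N) a i)%:E) @ \oo -->
    (\esum_(i in [set: gen n]) (a i)%:E)%E.
Proof.
case: n a => [m|] a a0 /=.
  have -> : [set: 'I_m] = [set` enum 'I_m].
    by apply/seteqP; split => // i _; rewrite /= mem_enum.
  rewrite esum_fset//; last by move=> i _; rewrite lee_fin.
  by rewrite -fsbig_seq ?enum_uniq// sumEFin; exact: cvg_cst.
rewrite -nneseries_esumT; last by move=> i; rewrite lee_fin.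
rewrite (_ : (fun _ => _) = (fun N => \sum_(0 <= i < N) (a i)%:E)%E).
  by apply: is_cvg_nneseries => i _ _; rewrite lee_fin.
by apply/funext => N; rewrite -sumEFin /index_iota subn0.
Qed.

(** * Hilbert space geometry *)

Section Hilbert.
Variables (R : realType) (H : completeNormedModType R[i]).
Variable dot : {dot H for @Num.conj R[i]}.
Hypothesis dot_norm : forall x : H, dot x x = `|x| ^+ 2.

Local Notation sqn x := (rnorm x ^+ 2).

Lemma dotC (x y : H) : dot x y = (dot y x)^*.
Proof. by rewrite (hermC dot x y) mul1r. Qed.

Lemma dotDZ (x y : H) (c : R[i]) :
  dot (x + c *: y) (x + c *: y) =
  dot x x + (c * dot y x + (c * dot y x)^*) + `|c| ^+ 2 * dot y y.
Proof.
rewrite dnormD dnormZ /= addrAC linearZr_LR /= (dotC x y) -rmorphM /=.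
by rewrite conjCK [X in _ + X + _]addrC.
Qed.

Lemma dot_CauchySchwarz (x y : H) : `|dot x y| <= `|x| * `|y|.
Proof.
rewrite -(ler_pXn2r (isT : (0 < 2)%N)) ?nnegrE ?mulr_ge0// exprMn mulrC.
rewrite -!dot_norm; apply: quadratic_bound => [||c]; rewrite ?dnorm_ge0//.
by rewrite -dotDZ dnorm_ge0.
Qed.

Lemma dotl_cvg (T : Type) (F : set_system T) {FF : Filter F} (u : T -> H) x y :
  u @ F --> x -> (fun t => dot (u t) y) @ F --> dot x y.
Proof.
move=> ux; apply/cvgrPdist_lt => e e0.
have y0 : 0 < `|y| + 1 by rewrite ltr_wpDl.
move/cvgrPdist_lt : ux => /(_ (e / (`|y| + 1)) (divr_gt0 e0 y0)).
apply: filterS => t; rewrite ltr_pdivlMr//; apply: le_lt_trans.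
rewrite -linearBl/=; apply: (le_trans (dot_CauchySchwarz _ _)).
by rewrite ler_wpM2l// lerDl.
Qed.

Lemma dotr_cvg (T : Type) (F : set_system T) {FF : Filter F} (u : T -> H) x y :
  u @ F --> x -> (fun t => dot y (u t)) @ F --> dot y x.
Proof.
move=> ux; have : (fun t => dot (u t) y) @ F --> dot x y by exact: dotl_cvg.
move=> /cvgrPdist_lt {}ux.
apply/cvgrPdist_lt => e /ux; apply: filterS => t.
by rewrite !(dotC y) -rmorphB norm_conjC.
Qed.

Lemma dot_inj (x y : H) : (forall w, dot x w = dot y w) -> x = y.
Proof.
move=> xy; apply/eqP; rewrite -subr_eq0 -(dnorm_eq0 dot).
by rewrite linearBl /= xy subrr.
Qed.

Lemma dot_sqn (x : H) : dot x x = (sqn x)%:C%C.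
Proof. by rewrite dot_norm rmorphXn/= RRe_real ?normr_real. Qed.

Lemma orthogonal_closed_subspace (P : set H) :
  closed_subspace [set y | forall x, P x -> dot y x = 0].
Proof.
split=> [|x _|a y z yP zP x Px]; last 2 first.
- by rewrite linear0l.
- by rewrite linearDl/= linearZl_LR/= yP// zP// mulr0 addr0.
have -> : [set y | forall x, P x -> dot y x = 0] =
    \bigcap_(x in P) (fun y => dot y x) @^-1` [set 0] by [].
apply: closed_bigI => x _; apply: preimage_closed.
  by move=> y _; apply: dotl_cvg; exact: cvg_id.
exact/accessible_closed_set1/hausdorff_accessible/norm_hausdorff.
Qed.

(** * Riesz representation and adjoints *)

Section Riesz.
Variables (f : H -> R[i]) (K : R[i]).
Hypotheses (f_lin : scalar f) (K_ge0 : 0 <= K).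
Hypothesis f_bound : forall x, `|f x| <= K * `|x|.

(** If z represents f, then the energy of x is |x - z|^2 - |z|^2, so the
    representing vector is the minimizer of the energy. *)
Let energy x := `|x| ^+ 2 - (f x + (f x)^*).

Let add_conj_real (z : R[i]) : z + z^* \is Num.real.
Proof. by rewrite CrealE rmorphD/= conjCK addrC. Qed.

Let energy_real x : energy x \is Num.real.
Proof. by rewrite realB// realX// normr_real. Qed.

Let energyE x : energy x = (complex.Re (energy x))%:C%C.
Proof. by rewrite RRe_real. Qed.

Let energy_lb x : - K ^+ 2 <= energy x.
Proof.
rewrite -subr_ge0 opprK /energy -addrA addrCA.
have fx : f x + (f x)^* <= 2 * (K * `|x|).
  apply: le_trans (real_ler_norm (add_conj_real _)) _.
  rewrite (le_trans (ler_normD _ _))// norm_conjC.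
  by rewrite mulr_natl mulr2n lerD.
have -> : - (f x + (f x)^*) + (`|x| ^+ 2 + K ^+ 2) =
  (2 * (K * `|x|) - (f x + (f x)^*)) + (`|x| - K) ^+ 2 by ring.
rewrite addr_ge0 ?subr_ge0// real_exprn_even_ge0//.
by rewrite realB ?normr_real ?ger0_real.
Qed.

Let energyDZ x w c : energy (x + c *: w) =
  energy x + (c * (dot w x - f w) + (c * (dot w x - f w))^*) +
  `|c| ^+ 2 * dot w w.
Proof.
rewrite /energy -!dot_norm dotDZ [x + _]addrC f_lin !mulrBr !rmorphB !rmorphD/=.
by ring.
Qed.

(** A vector whose energy is within e^2 of the infimum works: moving it by
    c *: w lowers the energy by at most e^2, for every c. *)
Lemma almost_representer (e : R[i]) : 0 < e ->
  exists x, forall w, `|dot w x - f w| <= e * `|w|.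
Proof.
move=> e0; pose E := range (fun x => complex.Re (energy x)).
have lbE : lbound E (complex.Re (- K ^+ 2)).
  move=> _ [x _ <-]/=; rewrite -lecR -energyE RRe_real//.
  by rewrite realN realX// ger0_real.
have hE : has_inf E.
  by split; [exists (complex.Re (energy 0)), 0|exists (complex.Re (- K ^+ 2))].
have e2E : e ^+ 2 = (complex.Re (e ^+ 2))%:C%C.
  by rewrite RRe_real// realX// gtr0_real.
have re0 : 0 < complex.Re (e ^+ 2) by rewrite -ltcR -e2E exprn_gt0.
have [_ [x _ <-]/= xlt] := inf_adherent re0 hE.
exists x => w.
rewrite -(ler_pXn2r (isT : (0 < 2)%N)) ?nnegrE ?mulr_ge0 ?(ltW e0)// exprMn.
rewrite -dot_norm; apply: quadratic_bound => [||c].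
- by rewrite exprn_ge0// ltW.
- exact: dnorm_ge0.
have : energy x <= e ^+ 2 + energy (x + c *: w).
  rewrite e2E energyE [energy (x + _)]energyE -rmorphD lecR/=.
  apply: (le_trans (ltW xlt)); rewrite addrC lerD2l.
  by apply: ge_inf; [exists (complex.Re (- K ^+ 2))|exists (x + c *: w)].
by rewrite energyDZ -subr_ge0; congr (0 <= _); ring.
Qed.

(** The difference d of two almost representing vectors satisfies
    |d|^2 = (dot d x - f d) - (dot d y - f d), so that almost representing
    vectors with errors tending to 0 form a Cauchy sequence. *)
Theorem riesz_representation : exists z, forall x, f x = dot x z.
Proof.
have /choice[u uP] : forall k : nat, exists x : H, forall w,
    `|dot w x - f w| <= k.+1%:R^-1 * `|w|.
  by move=> k; apply: almost_representer; rewrite invr_gt0 ltr0n.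
have dist_u k l : `|u k - u l| <= k.+1%:R^-1 + l.+1%:R^-1.
  have [->|d0] := eqVneq (u k - u l) 0; first by rewrite normr0 addr_ge0.
  rewrite -(ler_pM2r (_ : 0 < `|u k - u l|)) ?normr_gt0// -expr2 -dot_norm.
  set d := u k - u l.
  rewrite -[X in X <= _](ger0_norm (dnorm_ge0 dot d)).
  have -> : dot d d = (dot d (u k) - f d) - (dot d (u l) - f d).
    by rewrite {2}/d linearBr/=; ring.
  by rewrite mulrDl; apply: le_trans (lerD (uP k d) (uP l d)); apply: ler_normB.
have near_half (e : R[i]) : 0 < e -> \forall k \near \oo, k.+1%:R^-1 < e / 2.
  by move=> e0; apply: natSinv_lt; rewrite divr_gt0.
have /cvg_ex[z uz] : cvg (u @ \oo).
  apply/cauchy_cvgP/cauchy_exP => e e0.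
  have [k0 _ k0P] := near_half e e0.
  exists (u k0), k0 => // l /= kl.
  rewrite -ball_normE/= (le_lt_trans (dist_u _ _))// [e]splitr.
  by rewrite ltrD//; apply: k0P => /=.
exists z => w; apply/esym/eqP; rewrite -subr_eq0; apply/negPn/negP => dN0.
have p0 : 0 < `|dot w z - f w| by rewrite normr_gt0.
(* a nonzero defect at w exceeds the bound e * |w| for this e *)
have w0 : 0 < `|w| + 1 by rewrite ltr_wpDl.
pose e := `|dot w z - f w| / (`|w| + 1).
have e0 : 0 < e by rewrite divr_gt0.
move/cvgrPdist_lt : uz => /(_ _ (divr_gt0 e0 (ltr0n _ 2))) uz.
have [k [k1 k2]] := filter_ex (filterI (near_half e e0) uz).
suff : `|dot w z - f w| <= e * `|w|.
  rewrite /e mulrAC ler_pdivlMr// ler_pM2l// gerDl.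
  by rewrite ler10.
have -> : dot w z - f w = dot w (z - u k) + (dot w (u k) - f w).
  by rewrite linearBr/=; ring.
rewrite (le_trans (ler_normD _ _))// [e]splitr mulrDl lerD//.
  rewrite (le_trans (dot_CauchySchwarz _ _))// mulrC ler_wpM2r//.
  exact: ltW.
by rewrite (le_trans (uP _ _))// ler_wpM2r// ltW.
Qed.

End Riesz.

Lemma adjoint_eq (A B : H -> H) :
  (forall x y, dot (A x) y = dot x (B y)) -> adjoint dot A = B.
Proof.
move=> AB; apply/funext => y; rewrite /adjoint.
case: xgetP => [z _ /= zP|/(_ (B y))/= []//].
apply/eqP; rewrite -subr_eq0 -(dnorm_eq0 dot) linearBr /=.
by rewrite -zP -AB subrr.
Qed.

(** The Riesz theorem for x |-> <A x, y> shows that the default value in the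
    definition of [adjoint] does not occur. *)
Lemma bounded_adjoint (A : {linear H -> H}) : bounded_op A ->
  forall x y, dot (A x) y = dot x (adjoint dot A y).
Proof.
move=> [M AM] x y.
have normE (v : H) : `|v| = (rnorm v)%:C%C by rewrite RRe_real ?normr_real.
have /choice[B BP] : forall y, exists z, forall x, dot (A x) y = dot x z.
  move=> {}y; apply: (@riesz_representation _ ((`|M|)%:C%C * `|y|)).
  - by move=> a u v; rewrite linearP linearDl linearZl_LR.
  - by rewrite mulr_ge0// lecR.
  - move=> v; rewrite (le_trans (dot_CauchySchwarz _ _))// mulrAC ler_wpM2r//.
    rewrite !normE -rmorphM lecR (le_trans (AM v))// ler_wpM2r ?ler_norm//.
    by rewrite -ler0c -normE.
by rewrite (adjoint_eq (fun u v => BP v u)) BP.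
Qed.

(** * The row sum and the defect operator *)

Section RowContraction.
Variables (n : option nat) (T : gen n -> {linear H -> H}) (S : H -> H).
Hypothesis T_bounded : forall i, bounded_op (T i).
Hypothesis T_sum : strong_sum (fun i => T i \o adjoint dot (T i)) S.
Hypothesis S_le1 : op_le dot S idfun.

Lemma dot_partial_sum (r : seq (gen n)) x y :
  dot (\sum_(i <- r) (T i \o adjoint dot (T i)) x) y =
  \sum_(i <- r) dot (adjoint dot (T i) x) (adjoint dot (T i) y).
Proof.
rewrite linear_sumlz; apply: eq_bigr => i _ /=.
exact: bounded_adjoint.
Qed.

Lemma sum_selfadjoint x y : dot (S x) y = dot x (S y).
Proof.
have Sxy : (fun N => dot (\sum_(i <- exhaustion n N)
    (T i \o adjoint dot (T i)) x) y) @ \oo --> dot (S x) y.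
  by apply: dotl_cvg; exact: (strong_sum_cvg T_sum).
apply: (cvg_unique (@norm_hausdorff _ _) Sxy).
rewrite (_ : (fun _ => _) = (fun N => dot x (\sum_(i <- exhaustion n N)
  (T i \o adjoint dot (T i)) y))).
  by apply: dotr_cvg; exact: (strong_sum_cvg T_sum).
apply/funext => N; rewrite dot_partial_sum [RHS]dotC dot_partial_sum.
by rewrite rmorph_sum; apply: eq_bigr => i _; exact: dotC.
Qed.

(** Self-adjointness transfers linearity from the other argument of the inner
    product. *)
Lemma sum_linear x y c : S (x + c *: y) = S x + c *: S y.
Proof.
apply: dot_inj => w.
by rewrite sum_selfadjoint !linearDl/= !linearZl_LR/= !sum_selfadjoint.
Qed.

Lemma esum_sqn_adjoint x :
  (\esum_(i in [set: gen n]) (sqn (adjoint dot (T i) x))%:E)%E =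
  (complex.Re (dot (S x) x))%:E.
Proof.
have a0 (i : gen n) : 0 <= sqn (adjoint dot (T i) x) by exact: sqr_ge0.
apply: (cvg_unique _ (esum_cvg a0)).
  exact: ereal_hausdorff.
apply: cvg_EFin; first by near=> N.
rewrite [X in X @ _ --> _](_ : _ = fun N => complex.Re
  (dot (\sum_(i <- exhaustion n N) (T i \o adjoint dot (T i)) x) x)).
  by apply: Re_cvg; apply: dotl_cvg; exact: (strong_sum_cvg T_sum).
apply/funext => N /=; rewrite dot_partial_sum.
under [in RHS]eq_bigr do rewrite dot_sqn.
by rewrite -rmorph_sum.
Unshelve. all: by end_near. Qed.

Lemma esum_sqn_adjoint_le x :
  (\esum_(i in [set: gen n]) (sqn (adjoint dot (T i) x))%:E <= (sqn x)%:E)%E.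
Proof.
rewrite esum_sqn_adjoint lee_fin.
have := S_le1 x; rewrite linearBl/= dot_sqn subr_ge0 lecE => /andP[_].
exact.
Qed.

(** The form <(I - S) y, x> obeys the Cauchy-Schwarz inequality for the
    positive operator I - S.  By hypothesis it vanishes at y = x, hence for
    every y, and (I - S) x = 0 by self-adjointness. *)
Lemma sum_fixed x :
  (\esum_(i in [set: gen n]) (sqn (adjoint dot (T i) x))%:E = (sqn x)%:E)%E ->
  S x = x.
Proof.
rewrite esum_sqn_adjoint => -[xE].
have Dx0 : dot (x - S x) x = 0.
  have := S_le1 x; rewrite linearBl/= dot_sqn subr_ge0 lecE xE.
  move=> /andP[/eqP/= Im0 _].
  by apply/eqP; rewrite subr_eq0 eq_complex/= xE -Im0 !eqxx.
have Dyx0 y : dot (y - S y) x = 0.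
  apply/eqP; rewrite -normr_eq0 -sqrf_eq0 eq_le exprn_ge0// andbT.
  rewrite -[leRHS](mul0r (dot (y - S y) y)).
  apply: quadratic_bound => // [|c]; first exact: S_le1.
  have := S_le1 (x + c *: y); rewrite /= sum_linear.
  have -> : x + c *: y - (S x + c *: S y) = (x - S x) + c *: (y - S y).
    by rewrite scalerBr opprD addrACA.
  rewrite linearDl/= !linearDr/= Dx0.
  rewrite !linearZl_LR !linearZr_LR/=.
  have -> : dot (x - S x) y = (dot (y - S y) x)^*.
    by rewrite -dotC linearBl/= sum_selfadjoint -linearBr.
  by rewrite rmorphM normCK; congr (0 <= _); ring.
apply/esym/eqP; rewrite -subr_eq0 -(dnorm_eq0 dot) linearBr/= -sum_selfadjoint.
by rewrite -linearBl/= Dyx0.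
Qed.

(** * Sums over words of a given length *)

Lemma word_adjoint (alpha : word n) x y :
  dot (word_op (fun i => T i) alpha x) y =
  dot x (adjoint dot (word_op (fun i => T i) alpha) y).
Proof.
elim: alpha x y => [|i alpha IH] x y /=.
  by rewrite (@adjoint_eq _ idfun).
have TE u v : dot ((T i \o word_op (fun i => T i) alpha) u) v =
    dot u ((adjoint dot (word_op (fun i => T i) alpha) \o adjoint dot (T i)) v).
  by rewrite /= bounded_adjoint// IH.
by rewrite TE (adjoint_eq TE).
Qed.

Lemma adjoint_word_cons i (alpha : word n) :
  adjoint dot (word_op (fun i => T i) (i :: alpha)) =
  adjoint dot (word_op (fun i => T i) alpha) \o adjoint dot (T i).
Proof.
by apply: adjoint_eq => x y /=; rewrite bounded_adjoint// word_adjoint.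
Qed.

Definition level_sum (k : nat) (x : H) : \bar R :=
  (\esum_(alpha in [set alpha : word n | size alpha = k])
     (sqn (adjoint dot (word_op (fun i => T i) alpha) x))%:E)%E.

Lemma level_sum0 x : level_sum 0 x = (sqn x)%:E.
Proof.
rewrite /level_sum (_ : [set _ | _] = [set [::]]); last first.
  by apply/seteqP; split=> [alpha /= /size0nil|alpha /= ->].
by rewrite esum_set1 ?lee_fin ?sqr_ge0//= (@adjoint_eq _ idfun).
Qed.

(** Splitting off the first letter of a word, which acts first in the adjoint
    of the corresponding product. *)
Lemma level_sumS k x :
  level_sum k.+1 x =
  (\esum_(i in [set: gen n]) level_sum k (adjoint dot (T i) x))%E.
Proof.
rewrite /level_sum esum_esum; last by move=> *; rewrite lee_fin sqr_ge0.
rewrite (@reindex_esum _ _ _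
  ([set: gen n] `*`` fun=> [set alpha | size alpha = k]) _
  (fun p => p.1 :: p.2)).
  by apply: eq_esum => -[i alpha] _; rewrite adjoint_word_cons.
split=> [[i alpha] [_ /= ->]//|[i a] [j b] _ _ [-> ->]//|].
by move=> [//|i alpha] /= [sz]; exists (i, alpha).
Qed.

Lemma level_sum_le k x : (level_sum k x <= (sqn x)%:E)%E.
Proof.
elim: k x => [|k IH] x; first by rewrite level_sum0.
rewrite level_sumS (le_trans _ (esum_sqn_adjoint_le x))//.
by apply: le_esum => i _.
Qed.

Definition isometric_at x := forall k, level_sum k x = (sqn x)%:E.

Lemma isometric_at_fixed x : isometric_at x -> S x = x.
Proof.
move=> /(_ 1%N); rewrite level_sumS => x1; apply: sum_fixed; rewrite -x1.
by apply: eq_esum => i _; rewrite level_sum0.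
Qed.

(** The sum of the level sums at the T_i^* x is |x|^2, which bounds the sum of
    their upper bounds |T_i^* x|^2: no term can lose anything. *)
Lemma isometric_at_adjoint x i :
  isometric_at x -> isometric_at (adjoint dot (T i) x).
Proof.
move=> xP k.
have level0 j : (0 <= level_sum k (adjoint dot (T j) x))%E.
  by apply: esum_ge0 => *; rewrite lee_fin sqr_ge0.
have fg : (fun j => level_sum k (adjoint dot (T j) x)) =
          (fun j => (sqn (adjoint dot (T j) x))%:E).
  apply: esum_squeeze_eq => [j||].
  - by rewrite level0 level_sum_le.
  - by rewrite (le_lt_trans (esum_sqn_adjoint_le x))// ltry.
  - by rewrite -level_sumS xP esum_sqn_adjoint_le.
exact: (congr1 (fun f => f i) fg).
Qed.

End RowContraction.

End Hilbert.

(** * The invariant subspace *)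

Theorem corollary4p3
    (R : realType) (H : completeNormedModType R[i])
    (dot : {dot H for @Num.conj R[i]})
    (dot_norm : forall x : H, dot x x = `|x| ^+ 2)
    (n : option nat) (n_gt0 : n <> Some 0%N)
    (T : gen n -> {linear H -> H})
    (T_bounded : forall i, bounded_op (T i))
    (T_row : row_contraction dot (fun i => T i))
    (T_ne1 : ~ strong_sum (fun i => T i \o adjoint dot (T i)) idfun)
    (h : H) (h_neq0 : h <> 0)
    (h_norm : forall k : nat, (0 < k)%N ->
      (\esum_(alpha in [set alpha : word n | size alpha = k])
        (rnorm (adjoint dot (word_op (fun i => T i) alpha) h) ^+ 2)%:E)%E
      = ((rnorm h ^+ 2)%:E)%E) :
  exists M : set H,
    [/\ closed_subspace M, M <> [set 0], M <> [set: H] &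
        forall i x, M x -> M (T i x)].
Proof.
have [S T_sum S_le1] := T_row.
have h_iso : isometric_at dot T h.
  by case=> [|k]; [exact: level_sum0|exact: h_norm].
exists [set y | forall x, isometric_at dot T x -> dot y x = 0].
split; first exact: orthogonal_closed_subspace.
(* the range of I - S is orthogonal to the isometric vectors *)
- move=> M0; apply: T_ne1; rewrite (_ : idfun = S)//; apply/funext => y.
  apply/eqP; rewrite -subr_eq0; apply/eqP.
  have : [set 0] (y - S y).
    rewrite -M0 => x /(isometric_at_fixed dot_norm T_bounded T_sum S_le1) Sx.
    rewrite linearBl/= (sum_selfadjoint dot_norm T_bounded T_sum).
    by rewrite Sx subrr.
  exact.
- move=> MT; apply: h_neq0.
  have : [set: H] h by [].
  by rewrite -MT => /(_ h h_iso)/eqP; rewrite dnorm_eq0 => /eqP.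
- move=> i y yM x x_iso; rewrite bounded_adjoint//; apply: yM.
  exact: (isometric_at_adjoint dot_norm T_bounded T_sum S_le1) x_iso.
Qed.
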